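(* Let $G$ be a $\sigma$-compact locally compact Abelian group. With the local rubber topology (LRT), the set $\mathcal{C}(G)$ of closed subsets of $G$ is a compact Hausdorff space. If the topology of $G$ has a countable base, then $\mathcal{C}(G)$ is metrisable.
   Context: $\mathcal{C}(G)$ is the set of all closed subsets of $G$. For $K\subset G$ compact and $V$ a neighbourhood of $0$ in $G$, set $U_{K,V}:=\{(P_1,P_2)\in\mathcal{C}(G)\times\mathcal{C}(G): P_1\cap K\subset P_2+V \text{ and } P_2\cap K\subset P_1+V\}$. The family $\{U_{K,V}: K \text{ compact},\ V \text{ open},\ 0\in V\}$ generates a uniformity on $\mathcal{C}(G)$; the LRT is the induced topology, with neighbourhoods $U_{K,V}(P)=\{Q\in\mathcal{C}(G):(Q,P)\in U_{K,V}\}$ of $P\in\mathcal{C}(G)$. *)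

(* Defs.v *)
From HB Require Import structures.
From mathcomp Require Import all_boot all_order all_algebra.
From mathcomp Require Import all_classical all_reals all_analysis.

Set Implicit Arguments.
Unset Strict Implicit.
Unset Printing Implicit Defensive.

Import GRing.Theory.

Local Open Scope classical_set_scope.
Local Open Scope ring_scope.

Definition sigma_compact (T : topologicalType) : Prop :=
  exists2 K : nat -> set T, (forall n, compact (K n)) & \bigcup_n K n = [set: T].

Definition metrisable (R : realType) (T : topologicalType) : Prop :=
  exists (M : metricType R) (f : T -> M) (g : M -> T),
    [/\ cancel f g, cancel g f, continuous f & continuous g].

Record closed_set (G : topologicalType) := ClosedSet {
  closed_set_val :> set G;
  closed_setP : closed closed_set_val }.

HB.instance Definition _ (G : topologicalType) := gen_eqMixin (closed_set G).
HB.instance Definition _ (G : topologicalType) := gen_choiceMixin (closed_set G).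

Section LocalRubber.
Variable G : topologicalZmodType.

Definition rubber (K V : set G) : set (closed_set G * closed_set G) :=
  [set P : closed_set G * closed_set G |
    P.1 `&` K `<=` [set x + v | x in P.2 & v in V] /\
    P.2 `&` K `<=` [set x + v | x in P.1 & v in V]].

(* The sets [rubber K V] form a filter base because
   [rubber (K `|` K') (V `&` V')] refines both [rubber K V] and [rubber K' V']. *)
Definition rubber_entourage : set_system (closed_set G * closed_set G) :=
  filter_from [set KV : set G * set G | [/\ compact KV.1, open KV.2 & KV.2 0]]
              (fun KV => rubber KV.1 KV.2).

Lemma rubber_mono (K K' V V' : set G) :
  K `<=` K' -> V' `<=` V -> rubber K' V' `<=` rubber K V.
Proof.
move=> KK' V'V [P Q] [/= PQ QP]; split=> /= x [Px Kx].
  have [y Qy [v Vv <-]] := PQ _ (conj Px (KK' _ Kx)).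
  by exists y => //; exists v => //; apply: V'V.
have [y Qy [v Vv <-]] := QP _ (conj Px (KK' _ Kx)).
by exists y => //; exists v => //; apply: V'V.
Qed.

Lemma rubber_entourage_filter : Filter rubber_entourage.
Proof.
apply: filter_from_filter.
  by exists (set0, setT); split=> //=; [exact: compact0|exact: openT].
move=> [K V] [K' V'] [/= cK oV V0] [/= cK' oV' V'0].
exists (K `|` K', V `&` V') => /=.
  by split=> /=; [exact: compactU|exact: openI|split].
move=> P rP; split; apply: rubber_mono rP.
- exact: subsetUl.
- exact: subIsetl.
- exact: subsetUr.
- exact: subIsetr.
Qed.

Lemma rubber_entourage_refl (A : set (closed_set G * closed_set G)) :
  rubber_entourage A -> diagonal `<=` A.
Proof.
move=> [[K V] [/= _ _ V0] KVA] [P Q] /diagonalP <-; apply: KVA.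
by split=> /= x [Px _]; exists x => //; exists 0 => //; rewrite addr0.
Qed.

Lemma rubber_entourage_inv (A : set (closed_set G * closed_set G)) :
  rubber_entourage A -> rubber_entourage (A^-1)%relation.
Proof.
move=> [[K V] KVP KVA]; exists (K, V) => // -[P Q] [/= PQ QP].
exact: (KVA (Q, P)).
Qed.

Hypothesis lcG : locally_compact [set: G].

Lemma rubber_entourage_split (A : set (closed_set G * closed_set G)) :
  rubber_entourage A ->
  exists2 B, rubber_entourage B & (B \; B)%relation `<=` A.
Proof.
move=> [[K V] [/= cK oV V0] KVA].
have [C C0 [cC _]] : exists2 C, nbhs (0 : G) C & compact C /\ closed C.
  by have [C] := lcG (I : [set: G] 0); rewrite withinET; exists C.
have /(_ V)[] := @add_continuous G (0, 0).
  by rewrite /= addr0; exact: open_nbhs_nbhs.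
move=> [A1 A2] [/= A10 A20] A12V.
pose W := interior (A1 `&` A2 `&` C).
have W0 : W 0 by apply: filterI => //; apply: filterI.
have sW : W `<=` A1 `&` A2 `&` C by exact: interior_subset.
pose D := [set x.1 - x.2 | x in K `*` C].
have cD : compact D.
  apply: continuous_compact; last exact: compact_setX.
  by apply: continuous_subspaceT; exact: sub_continuous.
exists (rubber (K `|` D) W).
  exists (K `|` D, W) => //.
  by split=> //=; [exact: compactU|exact: open_interior].
have key (P Q S : set G) :
    P `&` (K `|` D) `<=` [set x + v | x in Q & v in W] ->
    Q `&` (K `|` D) `<=` [set x + v | x in S & v in W] ->
    P `&` K `<=` [set x + v | x in S & v in V].
  move=> PQ QS x [Px Kx].
  have [y Qy [w Ww xE]] := PQ x (conj Px (or_introl Kx)).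
  have Dy : D y.
    exists (x, w); first by split=> //=; have [] := sW _ Ww.
    by rewrite /= -xE addrK.
  have [z Sz [w' Ww' yE]] := QS y (conj Qy (or_intror Dy)).
  exists z => //; exists (w' + w); last by rewrite addrA yE.
  by apply: (A12V (w', w)); split=> /=; [have [[]] := sW _ Ww'|have [[]] := sW _ Ww].
move=> [P S] [Q [/= PQ QP] [/= QS SQ]]; apply: KVA.
by split; [exact: key PQ QS|exact: key SQ QP].
Qed.

End LocalRubber.

(* The argument [lcG] only serves to let the uniform structure below be found:
   local compactness of [G] is what makes the rubber sets a uniformity. *)
Definition rubber_space (G : topologicalZmodType)
  (lcG : locally_compact [set: G]) : Type := closed_set G.

HB.instance Definition _ (G : topologicalZmodType)
    (lcG : locally_compact [set: G]) :=
  Choice.on (rubber_space lcG).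

(* Since [rubber K V] is symmetric, the induced neighbourhoods of [P], given by
   [{Q | (P, Q) \in rubber K V}], are also [{Q | (Q, P) \in rubber K V}]. *)
HB.instance Definition _ (G : topologicalZmodType)
    (lcG : locally_compact [set: G]) :=
  isUniform.Build (rubber_space lcG) (rubber_entourage_filter G)
    (@rubber_entourage_refl G) (@rubber_entourage_inv G)
    (rubber_entourage_split lcG).

(* Main.v *)
(* Compactness: an ultrafilter F of closed sets converges to the set P of the
   points all of whose neighbourhoods are hit by F-almost every closed set. By
   the ultrafilter property, a point outside P has a neighbourhood missed by
   F-almost every closed set, so compactness of K yields both inclusions
   defining [rubber K V].
   Separation: testing with K = {x} shows that two closed sets related by every
   entourage have the same points.
   Metrisability: sigma-compactness and local compactness give a sequence of
   compact sets absorbing every compact set; together with a countable base of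
   neighbourhoods of 0 it yields a countable base of entourages, hence a bounded
   pseudometric, which is a metric by separation. *)
Require Import Defs.
From HB Require Import structures.
From mathcomp Require Import all_boot all_order all_algebra.
From mathcomp Require Import all_classical all_reals all_analysis.

Set Implicit Arguments.
Unset Strict Implicit.
Unset Printing Implicit Defensive.

Import Order.TTheory GRing.Theory Num.Theory.

Local Open Scope classical_set_scope.
Local Open Scope ring_scope.

(** A copy of [T], which already carries a pseudometric; [hT] and [fT] are arguments so that the
    metric below can be found from the type. *)
Definition edist_space (R : realType) (T : pseudoMetricType R)
  (hT : hausdorff_space T) (fT : forall xy : T * T, edist xy \is a fin_num) :
  Type := T.

Section edist_space.
Context {R : realType} {T : pseudoMetricType R} (hT : hausdorff_space T).
Context (fT : forall xy : T * T, edist xy \is a fin_num).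

Let d (x y : edist_space hT fT) : R := fine (edist ((x : T), (y : T))).

Let d_xx x : d x x = 0.
Proof. by rewrite /d edist_refl. Qed.

Let d_eq0 x y : d x y = 0 -> x = y.
Proof.
move=> dxy; apply: (close_eq hT); apply/edist_closeP.
by rewrite -[LHS]fineK ?fT// -/(d x y) dxy.
Qed.

Let d_sym x y : d x y = d y x.
Proof. by rewrite /d edist_sym. Qed.

Let d_triangle y x z : d x z <= d x y + d y z.
Proof. by rewrite -lee_fin EFinD !fineK ?fT//; exact: edist_triangle. Qed.

HB.instance Definition _ := Choice.on (edist_space hT fT).
HB.instance Definition _ :=
  isMetric.Build R (edist_space hT fT) d_xx d_eq0 d_sym d_triangle.

Lemma metrisable_edist : metrisable R T.
Proof.
exists (edist_space hT fT : metricType R), id, id; split=> //.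
- move=> x A /nbhs_ballP[e /= e0 eA]; apply/nbhs_ballP.
  (* Lying in a ball of radius [r] only gives [edist] at most [r]; halving makes the bound
     strict. *)
  exists (e / 2); first by rewrite /= divr_gt0.
  move=> y xy; apply: eA; rewrite ballEmdist /=.
  have /le_lt_trans : d x y <= e / 2.
    by rewrite -lee_fin fineK ?fT// edist_fin// divr_gt0.
  by apply; rewrite ltr_pdivrMr// ltr_pMr// ltr1n.
- move=> x A /nbhs_ballP[e /= e0 eA]; apply/nbhs_ballP.
  exists e => // y; rewrite ballEmdist /= => xy; apply: eA.
  by apply: (@edist_lt_ball R T e (x, y)); rewrite -[ltLHS]fineK ?fT// lte_fin.
Qed.

End edist_space.

Lemma metrisable_countable_uniformity (R : realType) (T : uniformType) :
  hausdorff_space T -> countable_uniformity T -> metrisable R T.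
Proof.
move=> hT cT; pose T' : pseudoMetricType R := countable_uniform cT.
apply: (@metrisable_edist R T' hT) => xy; apply/edist_finP.
(* In this pseudometric any two points are within a ball of radius 2. *)
by exists 2 => //; exact: countable_uniform.countable_uniform_bounded.
Qed.

Section rubber_space.
Context {G : topologicalZmodType} (lcG : locally_compact [set: G]).

Lemma nbhs_sub2 (V : set G) (x : G) :
  nbhs 0 V -> exists2 U, nbhs x U & forall y z, U y -> U z -> V (y - z).
Proof.
move=> V0; have /(_ V)[] := @sub_continuous G (x, x); first by rewrite /= subrr.
move=> [U1 U2] /= [xU1 xU2] UV; exists (U1 `&` U2); first exact: filterI.
by move=> y z [yU1 _] [_ zU2]; exact: (UV (y, z)).
Qed.

Lemma nbhs_sub (V : set G) (x : G) :
  nbhs 0 V -> nbhs x [set y | V (y - x)].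
Proof.
move=> /(nbhs_sub2 x)[U xU UV]; apply: filterS (xU) => y Uy.
exact: UV Uy (nbhs_singleton xU).
Qed.

(* The limit of the ultrafilter F for the local rubber topology. *)
Definition hits (F : set_system (closed_set G)) : set G :=
  [set x | forall U, nbhs x U -> F [set Q : closed_set G | Q `&` U !=set0]].

Lemma closed_hits F : closed (hits F).
Proof.
move=> x Fx U /nbhs_interior/Fx[y [Fy]]; exact: Fy.
Qed.

(** Each inclusion is checked near one point for [F]-almost every [Q]; compactness makes it hold on
    the whole compact set at once. *)
Lemma rubber_hits (F : set_system (closed_set G)) (K V : set G) :
  UltraFilter F -> compact K -> nbhs 0 V ->
  F [set Q | rubber K V (ClosedSet (@closed_hits F), Q)].
Proof.
move=> FU cK V0; apply: filterI => /=.
- have /compact_near_coveringP cov := compact_closedI cK (@closed_hits F).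
  rewrite setIC; apply: (cov _ F (fun (Q : closed_set G) (x : G) =>
    [set x + v | x in Q & v in V] x)) => x [Kx Fx].
  (* Differences in [U] lie in [V], so one point of [Q] in [U] serves every [y] in [U]. *)
  have [U xU UV] := nbhs_sub2 x V0.
  exists (U, [set Q : closed_set G | Q `&` U !=set0]) => /=.
    by split=> //; exact: Fx.
  move=> [y Q] /= [Uy [z [Qz Uz]]]; exists z => //; exists (y - z).
    exact: UV.
  by rewrite addrC subrK.
(* As [Q] varies, [K] itself is covered and membership in [Q] becomes a premise. *)
- have /compact_near_coveringP cov := cK.
  apply: filterS (cov _ F (fun (Q : closed_set G) (x : G) =>
    closed_set_val Q x -> [set x + v | x in hits F & v in V] x) _ _) => [Q KQ x [Qx Kx]|x Kx].
    exact: KQ.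
  have [Fx|] := pselect (hits F x).
    exists ([set y | V (y - x)], setT) => /=.
      by split; [exact: nbhs_sub|exact: filterT].
    move=> [y Q] /= [Vyx _] _; exists x => //; exists (y - x) => //.
    by rewrite addrC subrK.
  (* Off the limit, some [U] is missed by [F]-almost every [Q], so the premise fails on [U]. *)
  move=> /existsNP[U /not_implyP[xU nFU]].
  have [//|FnU] := in_ultra_setVsetC [set Q : closed_set G | Q `&` U !=set0] FU.
  exists (U, ~` [set Q : closed_set G | Q `&` U !=set0]) => //.
  by move=> [y Q] /= [Uy QU] Qy; case: QU; exists y.
Qed.

Lemma rubber_space_compact : compact [set: rubber_space lcG].
Proof.
rewrite compact_ultra => F FU _.
exists (ClosedSet (@closed_hits F)); split=> // A /nbhsP[E [[K V]]].
move=> [/= cK oV V0] KVE EA.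
have := rubber_hits FU cK (open_nbhs_nbhs (conj oV V0)).
by apply: filterS => Q FQ; apply: EA; apply/xsectionP; exact: KVE.
Qed.

Lemma rubber_sub (P Q : closed_set G) :
  (forall A, rubber_entourage A -> A (P, Q)) -> P `<=` Q.
Proof.
move=> PQ x Px; apply: (closed_setP (c:=Q)) => U xU.
(* With [V] inside this set, [x = q + v] forces [q = x - v] into [U]. *)
have : nbhs (0 : G) [set v | U (x - v)].
  have : (fun v => x - v) @ (0 : G) --> x - 0; last by apply; rewrite subr0.
  apply: (@continuous_comp _ _ _ (fun y => (x, y)) (fun y : G * G => y.1 - y.2)).
    by apply: cvg_pair => /=; [exact: cvg_cst|exact: cvg_id].
  exact: sub_continuous.
rewrite nbhsE => -[V [oV V0] VU].
have [] : rubber [set x] V (P, Q).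
  by apply: PQ; exists ([set x], V) => //; split=> //=; exact: compact_set1.
move=> /(_ x (conj Px erefl))[q Qq [v Vv qvx]] _; exists q; split=> //.
by have := VU _ Vv; rewrite /= -qvx addrK.
Qed.

Lemma rubber_space_hausdorff : hausdorff_space (rubber_space lcG).
Proof.
move=> P Q; rewrite -closeEnbhs entourage_close => PQ.
have PQE : P = Q :> set G.
  apply/seteqP; split; apply: rubber_sub => // A /rubber_entourage_inv AE.
  exact: PQ AE.
case: P Q PQE {PQ} => [P cP] [Q cQ] /= PQE.
case: _ / PQE in cQ *; congr ClosedSet; exact: Prop_irrelevance.
Qed.

(** The [K n] may have empty interior. Thickening their finite unions by a compact neighbourhood [C]
    of 0 gives each [x] in [K i] the neighbourhood [x + C], contained in every term of index above
    [i]. *)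
Lemma compact_exhaustion : sigma_compact G ->
  exists2 L : nat -> set G, forall n, compact (L n) &
    forall K, compact K -> exists n, K `<=` L n.
Proof.
move=> [K cK KT].
have [C C0 [cC _]] : exists2 C, nbhs (0 : G) C & compact C /\ closed C.
  by have [C] := lcG (I : [set: G] 0); rewrite withinET; exists C.
pose M n := \bigcup_(i < n) K i.
exists (fun n => [set x.1 + x.2 | x in M n `*` C]) => [n|A cA].
  apply: continuous_compact.
    by apply: continuous_subspaceT; exact: add_continuous.
  by apply: compact_setX => //; rewrite /M bigcup_mkord; exact: bigsetU_compact.
have /compact_near_coveringP cov := cA.
have [|n _ An] :=
  cov _ \oo (fun n => [set x.1 + x.2 | x in M n `*` C]) _; last first.
  by exists n; exact: An (leqnn n).
move=> x Ax.
have [i _ Kix] : (\bigcup_n K n) x by rewrite KT.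
exists ([set y | C (y - x)], [set n | (i < n)%N]) => /=.
  by split; [exact: nbhs_sub|exists i.+1].
move=> [y n] /= [Cyx ni]; exists (x, y - x) => /=; last by rewrite addrC subrK.
by split=> //; exists i.
Qed.

Lemma rubber_space_countable_uniformity : sigma_compact G ->
  @second_countable G -> countable_uniformity (rubber_space lcG).
Proof.
move=> /compact_exhaustion[L cL Lexh] [B cB [oB nB]].
exists (\bigcup_n rubber (L n) @` [set V | B V /\ V 0]); split.
- apply: bigcup_countable => // n _.
  apply: sub_countable (card_image_le _ _) _.
  by apply: sub_countable cB; apply: subset_card_le => V [].
- move=> _ [n _ [V [BV V0] <-]]; exists (L n, V) => //.
  by split=> //=; exact: oB.
- move=> A [[K V] [/= cK oV V0] KVA]; have [n Kn] := Lexh _ cK.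
  have [W [BW W0] WV] := nB 0 V (open_nbhs_nbhs (conj oV V0)).
  (* Enlarging [K] to [L n] and shrinking [V] to [W] both shrink the entourage. *)
  exists (rubber (L n) W); first by exists n => //; exists W.
  by apply: subset_trans KVA; exact: rubber_mono.
Qed.

End rubber_space.

Theorem theorem3 (R : realType) (G : topologicalZmodType)
    (hausG : hausdorff_space G) (lcG : locally_compact [set: G])
    (scG : sigma_compact G) :
  compact [set: rubber_space lcG] /\
  hausdorff_space (rubber_space lcG) /\
  (@second_countable G -> metrisable R (rubber_space lcG)).
Proof.
split; first exact: rubber_space_compact.
split; first exact: rubber_space_hausdorff.
move=> scntG; apply: metrisable_countable_uniformity.
  exact: rubber_space_hausdorff.
exact: rubber_space_countable_uniformity.
Qed.
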